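(* Let $d\ge 3$ be an odd integer. The branch kernel of $G_d$ is non-trivial.
   Context: Let $d\ge 3$ be odd and $X=\{1,\dots,d\}$. Let $T$ be the $d$-regular rooted tree whose vertex set is the set $X^*$ of finite words over $X$, with root the empty word, the children of $u$ being $ux$, $x\in X$; $X^k$ is the $k$-th level. $\mathrm{Aut}(T)$ is the group of root-preserving graph automorphisms of $T$, with product $gh(u)=h(g(u))$ and identity $e$. For $g\in\mathrm{Aut}(T)$ and $u\in X^*$, the section $g|_u\in\mathrm{Aut}(T)$ is determined by $g(uv)=g(u)\,g|_u(v)$ for all $v\in X^*$. The wreath recursion of $g$ is $g=(g|_1,\dots,g|_d)\lambda_g$, where $\lambda_g\in S_d$ is the permutation induced by $g$ on $X$; it determines $g$. The group $G_d\le \mathrm{Aut}(T)$ is generated by $A=\{a_1,\dots,a_d\}$, defined recursively by: for $1\le i\le d-1$, $\lambda_{a_i}=(i\ \,i+1)$, $a_i|_i=a_i$, $a_i|_{i+1}=a_{i+1}$, and $a_i|_x=e$ for all other $x\in X$; and $\lambda_{a_d}=(d\ 1)$, $a_d|_1=a_1$, $a_d|_d=a_d$, and $a_d|_x=e$ for all other $x\in X$. For $G\le\mathrm{Aut}(T)$ and a vertex $u$, $\mathrm{Rist}_{G}(u)$ is the subgroup of elements of $G$ fixing every vertex not of the form $uv$ with $v\in X^*$; $\mathrm{Rist}_{G}(\widehat{k})$ is the subgroup generated by all $\mathrm{Rist}_{G}(u)$, $u\in X^k$. For a branch group $G$ (level-transitive with all $\mathrm{Rist}_G(\widehat{k})$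 of finite index; $G_d$ is such a group), put $\widehat{G}=\varprojlim_{N} G/N$, over all finite index normal subgroups $N$ of $G$, and $\widetilde{G}=\varprojlim_{k\ge1} G/\mathrm{Rist}_G(\widehat{k})$. The branch kernel of $G$ is the kernel of the natural surjection $\widehat{G}\to\widetilde{G}$. *)

(* Defs.v *)
From HB Require Import structures.
From mathcomp Require Import all_boot.
From mathcomp Require Import fingroup perm.
From mathcomp Require Import mathcomp_extra boolp classical_sets functions.
From mathcomp Require Import cardinality.

Set Implicit Arguments.
Unset Strict Implicit.
Unset Printing Implicit Defensive.

Local Open Scope classical_set_scope.
Local Open Scope group_scope.

Section TreeAutomorphisms.
Variable X : finType.
Implicit Types (u v w : seq X) (x y : X).

(* The tree has vertex set X^*, and rcons u x is the child ux of u. *)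
Definition tree_adj u v : bool :=
  [exists x, v == rcons u x] || [exists x, u == rcons v x].

Record tree_aut := TreeAut {
  tfun :> seq X -> seq X;
  tinv : seq X -> seq X;
  tfunK : cancel tfun tinv;
  tinvK : cancel tinv tfun;
  tfun_root : tfun [::] = [::];
  tfun_adj : forall u v, tree_adj (tfun u) (tfun v) = tree_adj u v }.

Lemma tree_autP (g h : tree_aut) : g =1 h -> g = h.
Proof.
case: g h => [f f' K K' r a] [h h' H H' r2 a2] /= /funext e; subst h.
have e : f' = h' by apply/funext => u; rewrite -{1}(H' u) K.
subst h'; congr TreeAut; exact: Prop_irrelevance.
Qed.

HB.instance Definition _ := gen_eqMixin tree_aut.
HB.instance Definition _ := gen_choiceMixin tree_aut.

Definition taut1 : tree_aut :=
  @TreeAut id id (fun _ => erefl) (fun _ => erefl) erefl (fun _ _ => erefl).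

Section Operations.
Variables g h : tree_aut.

Fact taut_inv_root : tinv g [::] = [::].
Proof. by rewrite -{1}(tfun_root g) tfunK. Qed.

Fact taut_inv_adj u v : tree_adj (tinv g u) (tinv g v) = tree_adj u v.
Proof. by rewrite -(tfun_adj g) !tinvK. Qed.

Definition taut_inv : tree_aut :=
  TreeAut (tinvK g) (tfunK g) taut_inv_root taut_inv_adj.

Fact taut_mul_root : h (g [::]) = [::].
Proof. by rewrite !tfun_root. Qed.

Fact taut_mul_adj u v : tree_adj (h (g u)) (h (g v)) = tree_adj u v.
Proof. by rewrite !tfun_adj. Qed.

(* Automorphisms act on the right: (g * h) u = h (g u), as for {perm X}. *)
Definition taut_mul : tree_aut :=
  @TreeAut (fun u => h (g u)) (fun u => tinv g (tinv h u))
    (can_comp (tfunK h) (tfunK g)) (can_comp (tinvK g) (tinvK h))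
    taut_mul_root taut_mul_adj.

End Operations.

Fact taut_mulA : associative taut_mul.
Proof. by move=> g h k; apply: tree_autP. Qed.

Fact taut_mul1 : left_id taut1 taut_mul.
Proof. by move=> g; apply: tree_autP. Qed.

Fact taut_1mul : right_id taut1 taut_mul.
Proof. by move=> g; apply: tree_autP. Qed.

Fact taut_mulV : left_inverse taut1 taut_inv taut_mul.
Proof. by move=> g; apply: tree_autP => u /=; rewrite tinvK. Qed.

Fact taut_Vmul : right_inverse taut1 taut_inv taut_mul.
Proof. by move=> g; apply: tree_autP => u /=; rewrite tfunK. Qed.

HB.instance Definition _ := isGroup.Build tree_aut
  taut_mulA taut_mul1 taut_1mul taut_mulV taut_Vmul.

Lemma tautM (g h : tree_aut) u : (g * h) u = h (g u).
Proof. by []. Qed.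

Lemma taut_rcons (g : tree_aut) u x : exists y, g (rcons u x) = rcons (g u) y.
Proof.
elim/last_ind: u x => [|u z IHu] x.
  have : tree_adj (g [::]) (g [:: x]).
    by rewrite tfun_adj; apply/orP; left; apply/existsP; exists x.
  rewrite tfun_root => /orP[/existsP[y /eqP ->]|/existsP[y]]; first by exists y.
  by case: (g [:: x]).
have : tree_adj (g (rcons u z)) (g (rcons (rcons u z) x)).
  by rewrite tfun_adj; apply/orP; left; apply/existsP; exists x.
case/orP => /existsP[y /eqP e]; first by exists y.
have [t et] := IHu z; move: e; rewrite et => /rcons_inj[/(can_inj (tfunK g))].
by move=> /(congr1 size); rewrite !size_rcons => /eqP; rewrite -addn2 -[X in X == _]addn0 eqn_add2l.
Qed.

Lemma taut_cat (g : tree_aut) u v :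
  exists2 v', g (u ++ v) = g u ++ v' & size v' = size v.
Proof.
elim/last_ind: v => [|v x [v' e s]]; first by exists [::]; rewrite ?cats0.
have [y ey] := taut_rcons g (u ++ v) x.
by exists (rcons v' y); rewrite ?size_rcons ?s// -!rcons_cat ey e.
Qed.

Lemma size_taut (g : tree_aut) u : size (g u) = size u.
Proof. by have [v -> <-] := taut_cat g [::] u; rewrite tfun_root. Qed.

Lemma prefix_taut (g : tree_aut) u w : prefix (g u) (g w) = prefix u w.
Proof.
have imp (h : tree_aut) a b : prefix a b -> prefix (h a) (h b).
  by move=> /prefixP[v ->]; have [v' -> _] := taut_cat h a v; rewrite prefix_prefix.
apply/idP/idP; last exact: imp.
by move=> /(imp (taut_inv g)) /=; rewrite !tfunK.
Qed.

End TreeAutomorphisms.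

Section Subgroups.
Variable gT : groupType.
Implicit Types (A G H N : set gT) (x y : gT).

Definition is_subgroup H : Prop :=
  [/\ H 1, forall x y, H x -> H y -> H (x * y) & forall x, H x -> H x^-1].

Definition generated A : set gT :=
  [set x | forall H, is_subgroup H -> A `<=` H -> H x].

Definition normal_in G N : Prop :=
  [/\ is_subgroup N, N `<=` G & forall x g, N x -> G g -> N (x ^ g)].

Definition rcoset_of N g : set gT := [set n * g | n in N].

(* The quotient G / N, as the set of cosets of N (its identity is N). *)
Definition quotient_set G N : set (set gT) := [set rcoset_of N g | g in G].

Definition finite_index_normal G N : Prop :=
  normal_in G N /\ finite_set (quotient_set G N).

(* The inverse limit of the quotients G / N i: the families of cosets that are
   compatible with the projections G / N i -> G / N j, N i `<=` N j (such a
   projection maps a coset to the only coset containing it). The product is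
   pointwise, and the identity is the family N itself. *)
Definition inverse_limit (I : Type) G (N : I -> set gT) : set (I -> set gT) :=
  [set c | (forall i, quotient_set G (N i) (c i)) /\
           (forall i j, N i `<=` N j -> c i `<=` c j)].

Definition lim_mul (I : Type) (c c' : I -> set gT) : I -> set gT :=
  fun i => [set z | exists x y, [/\ c i x, c' i y & z = x * y]].

Definition lim_inv (I : Type) (c : I -> set gT) : I -> set gT :=
  fun i => [set z | exists2 x, c i x & z = x^-1].

Definition profinite_index G : Type := {N : set gT | finite_index_normal G N}.

Definition profinite_completion G : set (profinite_index G -> set gT) :=
  inverse_limit G (fun N : profinite_index G => sval N).

Definition profinite_one G : profinite_index G -> set gT :=
  fun N : profinite_index G => sval N.

Lemma generated_subgroup A : is_subgroup (generated A).
Proof.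
split=> [H []//|x y Ax Ay H sH AH|x Ax H sH AH].
  by case: (sH) => _ + _; apply; [exact: Ax|exact: Ay].
by case: (sH) => _ _; apply; exact: Ax.
Qed.

Lemma sub_generated A : A `<=` generated A.
Proof. by move=> x Ax H _; exact. Qed.

Section InverseLimitGroup.
Variables (I : Type) (G : set gT) (N : I -> set gT).
Hypotheses (sG : is_subgroup G) (nN : forall i, normal_in G (N i)).
Implicit Types (i j : I) (c : I -> set gT).
Local Notation lim := (inverse_limit G N).

Lemma rcoset_ofM i g h : G g -> G h ->
  [set z | exists x y, [/\ rcoset_of (N i) g x, rcoset_of (N i) h y & z = x * y]]
  = rcoset_of (N i) (g * h).
Proof.
have [[N1 NM NV] NG NJ] := nN i; have [_ _ GV] := sG.
move=> Gg Gh; apply/seteqP; split=> z.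
  move=> [_ [_ [[n Nn <-] [m Nm <-] ->]]].
  exists (n * m ^ g^-1); last by rewrite conjgE invgK !mulgA mulgKV.
  by apply: NM => //; apply: NJ => //; apply: GV.
move=> [n Nn <-]; exists (n * g), (1 * h); split.
- by exists n.
- by exists 1.
- by rewrite mul1g mulgA.
Qed.

Lemma rcoset_ofV i g : G g ->
  [set z | exists2 x, rcoset_of (N i) g x & z = x^-1] = rcoset_of (N i) g^-1.
Proof.
have [[N1 NM NV] NG NJ] := nN i; have [_ _ GV] := sG.
move=> Gg; apply/seteqP; split=> z.
  move=> [_ [n Nn <-] ->]; exists (n^-1 ^ g); first by apply: NJ => //; apply: NV.
  by rewrite conjgE invgM !mulgA mulgK.
move=> [n Nn <-]; exists (g * n^-1); last by rewrite invgM invgK.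
exists ((n^-1) ^ g^-1); last by rewrite conjgE invgK !mulgA mulgKV.
by apply: NJ; [exact: NV|exact: GV].
Qed.

Lemma rcoset_of1 i : rcoset_of (N i) 1 = N i.
Proof.
apply/seteqP; split=> [_ [n Nn <-]|n Nn]; first by rewrite mulg1.
by exists n => //; rewrite mulg1.
Qed.

Lemma lim_one_in : lim N.
Proof.
split=> // i; exists 1; last exact: rcoset_of1.
by have [] := sG.
Qed.

Lemma lim_mul_in c c' : lim c -> lim c' -> lim (lim_mul c c').
Proof.
have [_ GM _] := sG.
move=> [cq cc] [cq' cc']; split=> [i|i j ij _ [x [y [cx cy ->]]]].
  rewrite /lim_mul; have [g Gg <-] := cq i; have [h Gh <-] := cq' i.
  by rewrite rcoset_ofM //; exists (g * h) => //; apply: GM.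
by exists x, y; split=> //; [exact: (cc i)|exact: (cc' i)].
Qed.

Lemma lim_inv_in c : lim c -> lim (lim_inv c).
Proof.
have [_ _ GV] := sG.
move=> [cq cc]; split=> [i|i j ij _ [x cx ->]].
  rewrite /lim_inv; have [g Gg <-] := cq i.
  by rewrite rcoset_ofV //; exists g^-1 => //; apply: GV.
by exists x => //; exact: (cc i).
Qed.

Lemma lim_mulA c1 c2 c3 :
  lim_mul c1 (lim_mul c2 c3) = lim_mul (lim_mul c1 c2) c3.
Proof.
apply/funext => i; apply/seteqP; split=> z.
  move=> [x [_ [cx [y [t [cy ct ->]]] ->]]]; exists (x * y), t.
  by split; rewrite ?mulgA //; exists x, y.
move=> [_ [t [[x [y [cx cy ->]]] ct ->]]]; exists x, (y * t).
by split; rewrite ?mulgA //; exists y, t.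
Qed.

Lemma lim_mul1 c : lim c -> lim_mul N c = c.
Proof.
move=> [cq _]; apply/funext => i; have [G1 _ _] := sG; rewrite /lim_mul.
by have [g Gg <-] := cq i; rewrite -{1}rcoset_of1 rcoset_ofM // mul1g.
Qed.

Lemma lim_mulV c : lim c -> lim_mul (lim_inv c) c = N.
Proof.
move=> [cq _]; apply/funext => i; have [_ _ GV] := sG; rewrite /lim_mul /lim_inv.
have [g Gg <-] := cq i; rewrite rcoset_ofV // rcoset_ofM ?mulVg ?rcoset_of1 //.
exact: GV.
Qed.

End InverseLimitGroup.

End Subgroups.

Arguments profinite_completion {gT} G.
Arguments profinite_one {gT} G.

Section BranchGroups.
Variable X : finType.
Implicit Types (G : set (tree_aut X)) (u v w : seq X) (k : nat).

Definition rist G u : set (tree_aut X) :=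
  [set g | G g /\ forall w, ~~ prefix u w -> g w = w].

Definition rist_level G k : set (tree_aut X) :=
  generated (\bigcup_(u in [set u | size u = k]) rist G u).

Definition level_transitive G : Prop :=
  forall u v, size u = size v -> exists2 g, G g & g u = v.

Definition is_branch G : Prop :=
  [/\ is_subgroup G, level_transitive G
    & forall k, finite_set (quotient_set G (rist_level G k))].

(* The index k stands for level k + 1. *)
Definition branch_completion G : set (nat -> set (tree_aut X)) :=
  inverse_limit G (fun k => rist_level G k.+1).

Definition branch_one G : nat -> set (tree_aut X) :=
  fun k => rist_level G k.+1.

(* The restriction of a family to the subgroups rist_level G k.+1, with a
   conventional value when these do not have finite index; see branch_mapE and
   branch_map_completion for the case of a branch group. *)
Definition branch_map G (c : profinite_index G -> set (tree_aut X)) :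
    nat -> set (tree_aut X) :=
  fun k => if pselect (finite_index_normal G (rist_level G k.+1)) is left fin
           then c (exist _ (rist_level G k.+1) fin)
           else rist_level G k.+1.

Definition branch_kernel G : set (profinite_index G -> set (tree_aut X)) :=
  [set c | profinite_completion G c /\ branch_map c = branch_one G].

Lemma rist_level_normal G k : is_subgroup G -> normal_in G (rist_level G k).
Proof.
move=> sG; have [G1 GM GV] := sG.
split; first exact: generated_subgroup.
  by move=> x; apply => // y [u _ []].
move=> x g Rx Gg.
pose H := [set y | rist_level G k (y ^ g)].
apply: (Rx H).
  have [S1 SM SV] := generated_subgroup
    (\bigcup_(u in [set u | size u = k]) rist G u).
  split=> [|a b Ha Hb|a Ha]; rewrite /H /=.
  - by rewrite conj1g.
  - by rewrite conjMg; apply: SM.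
  - by rewrite conjVg; apply: SV.
move=> y [u /= su [Gy yu]]; apply: sub_generated; exists (g u).
  by rewrite /= size_taut.
split; first by rewrite conjgE; apply: (GM _ _ (GV _ Gg)); apply: GM.
move=> w Pw; rewrite conjgE !tautM /=.
rewrite (yu (tinv g w)) ?tinvK //.
by rewrite -(prefix_taut g) tinvK.
Qed.

Lemma branch_finite_index G k : is_branch G ->
  finite_index_normal G (rist_level G k).
Proof. by move=> [sG _ fG]; split; [exact: rist_level_normal|exact: fG]. Qed.

Lemma branch_mapE G (c : profinite_index G -> set (tree_aut X)) k
    (fin : finite_index_normal G (rist_level G k.+1)) :
  branch_map c k = c (exist _ (rist_level G k.+1) fin).
Proof.
rewrite /branch_map; case: pselect => // fin'.
by rewrite (Prop_irrelevance fin' fin).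
Qed.

Lemma branch_map_completion G (c : profinite_index G -> set (tree_aut X)) :
  is_branch G -> profinite_completion G c -> branch_completion G (branch_map c).
Proof.
move=> bG [cq cc]; split=> [k|k l kl].
  rewrite (branch_mapE _ (branch_finite_index k.+1 bG)).
  exact: (cq (exist _ _ (branch_finite_index k.+1 bG))).
rewrite (branch_mapE _ (branch_finite_index k.+1 bG)).
rewrite (branch_mapE _ (branch_finite_index l.+1 bG)).
exact: (cc (exist _ _ (branch_finite_index k.+1 bG))
           (exist _ _ (branch_finite_index l.+1 bG))).
Qed.

Lemma branch_mapM G (c c' : profinite_index G -> set (tree_aut X)) :
  is_branch G ->
  branch_map (lim_mul c c') = lim_mul (branch_map c) (branch_map c').
Proof.
move=> bG; apply/funext => k.
by rewrite /lim_mul !(branch_mapE _ (branch_finite_index k.+1 bG)).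
Qed.

End BranchGroups.

Arguments branch_kernel {X} G.

Section Generators.
Variable d : nat.
Implicit Types (i x y : 'I_d) (u v w : seq 'I_d).

(* Letters are numbered from 0 and ordS is the cyclic successor, so that the
   case i = d - 1 of the recursion is that of the last generator: it permutes
   the last and the first letters, with sections itself and the generator of
   index 0 there. *)
Fixpoint gen_fun i w : seq 'I_d :=
  if w is x :: v then
    tperm i (ordS i) x ::
      (if x == i then gen_fun i v
       else if x == ordS i then gen_fun (ordS i) v
       else v)
  else [::].

Fixpoint gen_inv i w : seq 'I_d :=
  if w is y :: v then
    let x := tperm i (ordS i) y in
    x :: (if x == i then gen_inv i v
          else if x == ordS i then gen_inv (ordS i) v
          else v)
  else [::].

Fact gen_funK i : cancel (gen_fun i) (gen_inv i).
Proof.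
move=> w; elim: w i => [|x v IHv] i //=; rewrite tpermK; congr cons.
by case: eqP => // _; case: eqP.
Qed.

Fact gen_invK i : cancel (gen_inv i) (gen_fun i).
Proof.
move=> w; elim: w i => [|x v IHv] i //=; rewrite tpermK; congr cons.
by case: eqP => // _; case: eqP.
Qed.

Fact gen_fun_rcons i u x : exists y, gen_fun i (rcons u x) = rcons (gen_fun i u) y.
Proof.
elim: u i => [|z u IHu] i /=.
  by exists (tperm i (ordS i) x); do 2?case: ifP.
case: ifP => _; first by have [y ->] := IHu i; exists y.
case: ifP => _; first by have [y ->] := IHu (ordS i); exists y.
by exists x.
Qed.

Fact gen_inv_rcons i u x : exists y, gen_inv i (rcons u x) = rcons (gen_inv i u) y.
Proof.
elim: u i => [|z u IHu] i /=.
  by exists (tperm i (ordS i) x); do 2?case: ifP.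
case: ifP => _; first by have [t ->] := IHu i; exists t.
case: ifP => _; first by have [t ->] := IHu (ordS i); exists t.
by exists x.
Qed.

Fact gen_adj i u v : tree_adj (gen_fun i u) (gen_fun i v) = tree_adj u v.
Proof.
have imp (f : seq 'I_d -> seq 'I_d) a b :
    (forall w x, exists y, f (rcons w x) = rcons (f w) y) ->
    tree_adj a b -> tree_adj (f a) (f b).
  move=> fr /orP[] /existsP[x /eqP ->]; apply/orP.
    by left; have [y ->] := fr a x; apply/existsP; exists y.
  by right; have [y ->] := fr b x; apply/existsP; exists y.
apply/idP/idP; last exact: (imp _ _ _ (@gen_fun_rcons i)).
by move=> /(imp _ _ _ (@gen_inv_rcons i)); rewrite !gen_funK.
Qed.

Definition gen i : tree_aut 'I_d :=
  TreeAut (gen_funK i) (gen_invK i) erefl (gen_adj i).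

End Generators.

Definition G_ (d : nat) : set (tree_aut 'I_d) := generated (range (@gen d)).
Arguments G_ : clear implicits.

(* Main.v *)
Require Import Defs.
From mathcomp Require Import all_boot.
From mathcomp Require Import perm ssralg ssrnum ssrint intdiv zify.
From mathcomp Require Import boolp classical_sets cardinality filter.

(** Write a_i for the i-th generator. The rigid stabilizers of all levels reach
one and the same nontrivial coset of a fixed subgroup of finite index, so that
the topology defined by these stabilizers is strictly coarser than the
profinite one. This rests on three facts.

The exponent sum of words induces a homomorphism from the group to the integers,
the degree (wdeg_trivial). Each generator has exactly two nontrivial sections on
the first level, both of them generators, so the degrees of the d sections of a
word add up to twice the degree of the word. On the other hand the sections of a
word are not longer than the word, and one that is as long has the same degree.
Hence a shortest word that represents the identity and has a nonzero degree has
exactly two sections of full length, which makes it a word in a single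
generator; its full sections then have the same property, and this is absurd.

Every Rist(0^k), with 0 the first letter, contains an element of degree 4
(quartic_rist), although its section at 0^k must have degree 4 * 2^k. To find
one, let L be the even part, the normal subgroup generated by the products
a_i a_(i+1), and let K = [L, L]. Elements of L whose nontrivial sections sit at
two letters only can be given any section of L at one of these letters, and the
commutator of two of them that share exactly this letter is concentrated there;
so a copy of K acting below the letter 0 is contained in K (comm_branching).
Modulo K, the square of a_i is centralized by the whole group, and a product of
two conjugates of it and of the inverse of a third one is concentrated at a
single letter, with a conjugate of (a_i a_(i+1))^2 as its section
(concentrated_sq). Two such elements multiply to one that is congruent to a_i^4
and has a section congruent to a_(i+1)^4 a_i^4. Thus the subgroup generated by K
and all fourth powers a_i^4 reproduces itself one level deeper at no cost in
degree (quartic_descent), and an induction gives elements of Rist(0^k) congruent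
to a_0^4 modulo K, on which the degree vanishes.

The degree modulo 3 has a kernel N of finite index. A limit point, in the
profinite completion, of a sequence of such elements of Rist(0^k) lies in the
closure of the rigid stabilizer of every level, hence in the branch kernel, and
its image in G / N is the class of a_0^4, which is not trivial. The limit point
is taken along an ultrafilter.

The parity of d enters through the fact that 2 generates the integers modulo d.
Therefore any letter can be moved to any other one with a trivial section, so
that the group is self-replicating, and all generators agree modulo L, so that L
contains their squares and has index at most 2. *)

Set Implicit Arguments.
Unset Strict Implicit.
Unset Printing Implicit Defensive.

Import GRing.Theory Num.Theory.
Local Open Scope classical_set_scope.
Local Open Scope group_scope.

(** * Subgroups *)

Section SubgroupTheory.
Variable gT : groupType.
Implicit Types (A G H N : set gT) (x y g : gT).

Lemma generated_min A H : is_subgroup H -> A `<=` H -> generated A `<=` H.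
Proof. by move=> sH AH x; apply. Qed.

Lemma subgroupJ H x y : is_subgroup H -> H x -> H y -> H (x ^ y).
Proof.
by move=> [_ HM HV] Hx Hy; rewrite conjgE; apply/(HM)/HM => //; exact: HV.
Qed.

Lemma subgroupX H x n : is_subgroup H -> H x -> H (x ^+ n).
Proof.
move=> [H1 HM _] Hx; elim: n => [|n IHn]; first by rewrite expg0.
by rewrite expgS; apply: HM.
Qed.

Lemma subgroup_preJ H g : is_subgroup H -> is_subgroup [set x | H (x ^ g)].
Proof.
move=> [H1 HM HV]; split=> [|x y /= Hx Hy|x /= Hx] /=.
- by rewrite conj1g.
- by rewrite conjMg; apply: HM.
- by rewrite conjVg; apply: HV.
Qed.

Lemma normal_generated G A : is_subgroup G -> A `<=` G ->
  (forall x g, A x -> G g -> generated A (x ^ g)) -> normal_in G (generated A).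
Proof.
move=> sG AG AJ; split; [exact: generated_subgroup|exact: generated_min|].
move=> x g Ax Gg; move: x Ax; apply: generated_min => [|x Ax].
  exact/subgroup_preJ/generated_subgroup.
exact: AJ.
Qed.

End SubgroupTheory.

(** * Sections *)

Section Sections.
Variable X : finType.
Implicit Types (g h k : tree_aut X) (x y z : X) (v : seq X).

(** Sections as a relation, so that no tree automorphism has to be built from
prescribed sections: existence is always that of an element of the group. *)
Definition section_at g x y h : Prop := forall v, g (x :: v) = y :: h v.

Lemma section1 x : section_at 1 x x 1.
Proof. by []. Qed.

Lemma sectionM g g' x y z h h' :
  section_at g x y h -> section_at g' y z h' -> section_at (g * g') x z (h * h').
Proof. by move=> gh gh' v; rewrite !tautM gh gh'. Qed.

Lemma sectionV g x y h : section_at g x y h -> section_at g^-1 y x h^-1.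
Proof.
move=> gh v; apply: (can_inj (tfunK g)).
by rewrite gh -!tautM !mulVg.
Qed.

Lemma section_fun g x y h y' h' :
  section_at g x y h -> section_at g x y' h' -> y = y' /\ h = h'.
Proof.
move=> gh gh'; have e v : y :: h v = y' :: h' v by rewrite -gh -gh'.
by split; [case: (e [::])|apply: tree_autP => v; case: (e v)].
Qed.

Lemma section_inj g x x' y h h' :
  section_at g x y h -> section_at g x' y h' -> x = x'.
Proof. by move=> /sectionV gx /sectionV gx'; have [] := section_fun gx gx'. Qed.

Lemma sectionJ g x y h k e :
  section_at g x y h -> section_at k x x e -> section_at (k ^ g) y y (e ^ h).
Proof.
by move=> gh ke; rewrite !conjgE; apply: sectionM (sectionV gh) _; apply: sectionM gh.
Qed.

End Sections.

(** * The cycle of letters *)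

Section Cycle.
Variable d : nat.
Hypothesis d3 : 3 <= d.
Implicit Types (i j x y : 'I_d).

Lemma val_ordS_lt i : i.+1 < d -> val (ordS i) = i.+1.
Proof. exact: modn_small. Qed.

Lemma ordS_neq i : ordS i != i.
Proof.
rewrite -val_eqE /=; have := ltn_ord i; rewrite leq_eqVlt => /predU1P[e|/modn_small ->]; last by lia.
by rewrite e modnn; lia.
Qed.

Lemma ordSS_neq i : ordS (ordS i) != i.
Proof.
rewrite -val_eqE /= -addn1 modnDml addn1; have := ltn_ord i.
rewrite leq_eqVlt => /predU1P[e|]; last first.
  rewrite leq_eqVlt => /predU1P[e|/modn_small ->]; last by lia.
  by rewrite e modnn; lia.
by rewrite -addn1 e -[X in X + 1]mul1n modnMDl modn_small; lia.
Qed.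

End Cycle.

(** * Words in the generators *)

Section Words.
Variable d : nat.
Hypothesis d3 : 3 <= d.
Implicit Types (i j x y : 'I_d) (w : seq (bool * 'I_d)).

Definition edge i x := (x == i) || (x == ordS i).

Lemma tperm_edge i x : edge i (tperm i (ordS i) x) = edge i x.
Proof.
rewrite /edge; case: tpermP => [->|->|_ _] //.
  by rewrite !eqxx orbT.
by rewrite !eqxx orbT.
Qed.

Lemma tperm_off i x : ~~ edge i x -> tperm i (ordS i) x = x.
Proof.
by rewrite negb_or => /andP[xi xsi]; rewrite tpermD // eq_sym.
Qed.

Lemma tperm_move i x : edge i x -> tperm i (ordS i) x != x.
Proof.
case/orP => /eqP ->; first by rewrite tpermL ordS_neq.
by rewrite tpermR eq_sym ordS_neq.
Qed.

Lemma gen_section i x :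
  section_at (gen i) x (tperm i (ordS i) x) (if edge i x then gen x else 1).
Proof.
move=> v; rewrite /= /edge; case: eqP => [->|_] //=.
by case: eqP => [->|_].
Qed.

Lemma genV_section i x :
  section_at (gen i)^-1 x (tperm i (ordS i) x)
    (if edge i x then (gen (tperm i (ordS i) x))^-1 else 1).
Proof.
have := sectionV (gen_section i (tperm i (ordS i) x)).
by rewrite tpermK tperm_edge; case: ifP => // _; rewrite invg1.
Qed.

(** A word is a list of pairs (b, i), standing for gen i when b holds and for its
inverse otherwise. *)
Definition weval w : tree_aut 'I_d :=
  foldr (fun l g => (if l.1 then gen l.2 else (gen l.2)^-1) * g) 1 w.

Definition wdeg w : int := foldr (fun l n => ((if l.1 then 1 else -1) + n)%R) 0%R w.

Definition winv w := rev [seq (~~ l.1, l.2) | l <- w].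

Fixpoint wact w x :=
  if w is (_, i) :: w' then wact w' (tperm i (ordS i) x) else x.

(** The section as an unreduced word, so that lengths can be compared. When gen i
moves x to y, its section at x is gen x; its inverse also moves x to y, and has
there the inverse of gen y. *)
Fixpoint wsection w x :=
  if w is (b, i) :: w' then
    let y := tperm i (ordS i) x in
    (if edge i x then [:: (b, if b then x else y)] else [::]) ++ wsection w' y
  else [::].

Lemma weval_cat w w' : weval (w ++ w') = weval w * weval w'.
Proof. by elim: w => [|l w IHw] /=; rewrite ?mul1g // IHw mulgA. Qed.

Lemma wdeg_cat w w' : wdeg (w ++ w') = (wdeg w + wdeg w')%R.
Proof. by elim: w => [|l w IHw] /=; rewrite ?add0r // IHw addrA. Qed.

Lemma weval_inv w : weval (winv w) = (weval w)^-1.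
Proof.
elim: w => [|[b i] w IHw] /=; first by rewrite invg1.
rewrite /winv /= rev_cons -cats1 weval_cat -/(winv w) IHw invgM /= mulg1.
by case: b; rewrite /= ?invgK.
Qed.

Lemma wdeg_inv w : wdeg (winv w) = (- wdeg w)%R.
Proof.
elim: w => [|[b i] w IHw] //=.
rewrite /winv /= rev_cons -cats1 wdeg_cat -/(winv w) IHw /=.
by rewrite addr0 opprD addrC; case: b; rewrite ?opprK.
Qed.

Lemma weval_section w x : section_at (weval w) x (wact w x) (weval (wsection w x)).
Proof.
elim: w x => [|[b i] w IHw] x /=; first exact: section1.
rewrite weval_cat; apply: sectionM (IHw _).
case: b => /=; [have := gen_section i x|have := genV_section i x];
  by case: ifP => _ /=; rewrite ?mulg1.
Qed.

Lemma size_wsection w x : size (wsection w x) <= size w.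
Proof.
elim: w x => [|[b i] w IHw] x //=; rewrite size_cat.
by have := IHw (tperm i (ordS i) x); case: ifP => _ /=; lia.
Qed.

(** A section is as long as the word when no pair of the word fixes the letter it
meets. *)
Lemma full_cons b i w x :
  (size (wsection ((b, i) :: w) x) == (size w).+1) =
  edge i x && (size (wsection w (tperm i (ordS i) x)) == size w).
Proof.
rewrite /= size_cat; case: ifP => _ /=; first by rewrite add1n eqSS.
by rewrite add0n; apply/negbTE; rewrite neq_ltn ltnS size_wsection.
Qed.

Lemma full_wdeg w x : size (wsection w x) = size w -> wdeg (wsection w x) = wdeg w.
Proof.
move/eqP; elim: w x => [|[b i] w IHw] x //; rewrite full_cons => /andP[ix /IHw e].
by rewrite /= ix wdeg_cat e /= addr0.
Qed.

(** Each letter moves exactly two letters of the alphabet, and at both of them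
its section is a generator with the same sign. *)
Lemma sum_wdeg_section w : (\sum_x wdeg (wsection w x) = wdeg w *+ 2)%R.
Proof.
elim: w => [|[b i] w IHw] /=; first by rewrite big1.
under eq_bigr => x _ do rewrite wdeg_cat.
rewrite big_split /= mulrnDl -IHw; congr (_ + _)%R; last first.
  by rewrite [RHS](reindex_inj (@perm_inj _ (tperm i (ordS i)))).
rewrite (bigD1 i) //= (bigD1 (ordS i)) ?ordS_neq //= big1 => [|x /andP[xi xsi]].
  by rewrite /edge !eqxx orbT /=; case: b.
by rewrite /edge (negbTE xi) (negbTE xsi).
Qed.

Lemma edge_pair i x y : x != y -> edge i x -> edge i y ->
  (x = i /\ y = ordS i) \/ (x = ordS i /\ y = i).
Proof.
move=> xy /orP[]/eqP ex /orP[]/eqP ey; rewrite {}ex {}ey in xy *; auto.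
  by rewrite eqxx in xy.
by rewrite eqxx in xy.
Qed.

Lemma edge_inj i j x y : x != y ->
  edge i x -> edge i y -> edge j x -> edge j y -> i = j.
Proof.
move=> xy ix iy jx jy.
have [[? ?]|[? ?]] := edge_pair xy ix iy; subst x y;
  have [[e e']|[e e']] := edge_pair xy jx jy => //.
- by have := ordSS_neq d3 i; rewrite e' e eqxx.
- by have := ordSS_neq d3 i; rewrite e e' eqxx.
Qed.

(** When two sections have full length, each pair of the word moves both current
letters, so it exchanges them and they remain the ends of the same edge of the
cycle; with at least three letters, this edge determines the generator. *)
Lemma two_full_pure w i x y : x != y -> edge i x -> edge i y ->
  size (wsection w x) = size w -> size (wsection w y) = size w ->
  all (fun l => l.2 == i) w.
Proof.
move=> + + + /eqP + /eqP; elim: w x y => [|[b j] w IHw] x y xy ix iy //.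
rewrite !full_cons => /andP[jx wx] /andP[jy wy].
have ij : i = j by exact: (edge_inj xy ix iy jx jy).
subst j; rewrite /= eqxx /=.
by apply: (IHw _ _ _ _ _ wx wy); rewrite ?(inj_eq perm_inj) ?tperm_edge.
Qed.

(** A positive pair contributes the generator of the letter that it meets, a
negative one that of the letter it leads to. If all these are gen j, then the
positive pairs lead away from j and the negative ones lead to j, so that the sum
of the signs telescopes. *)
Lemma pure_section_wdeg w i j x : edge i x ->
  all (fun l => l.2 == i) w -> all (fun l => l.2 == j) (wsection w x) ->
  wdeg w = ((x == j)%:Z - (wact w x == j)%:Z)%R.
Proof.
elim: w x => [|[b k] w IHw] x ix /=; first by rewrite subrr.
case/andP=> /eqP -> wi; rewrite ix /= => /andP[bj wj].
rewrite (IHw _ _ wi wj) ?tperm_edge //; have := tperm_move ix.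
by case: b bj => /= /eqP <-; rewrite eqxx 1?[x == _]eq_sym => /negPf ->; lia.
Qed.

(** By induction on the length. The sections of a trivial word are trivial, and
the shorter ones have degree 0 by induction. The others have the degree of the
word, and all of them add up to twice this degree: if it is not 0, there are
exactly two of full length, and the word is written in a single generator. This
applies again to a section of full length, and the preceding lemma makes the
degree 0, as a trivial word moves no letter. *)
Lemma wdeg_trivial w : weval w = 1 -> wdeg w = 0%R.
Proof.
have [n] := ubnP (size w); elim: n w => // n IHn w /ltnSE wn w1.
pose full u := [pred x | size (wsection u x) == size u].
have triv u x : weval u = 1 -> wact u x = x /\ weval (wsection u x) = 1.
  move=> u1; have := weval_section u x; rewrite u1 => ux.
  by have [-> ->] := section_fun ux (section1 x).
have two u : size u <= n -> weval u = 1 -> wdeg u <> 0%R ->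
    exists x y, [/\ x != y, full u x & full u y].
  move=> un u1 u0; have := sum_wdeg_section u.
  rewrite (bigID (full u)) /= addrC big1 ?add0r => [|x ux]; last first.
    apply: IHn (triv u x u1).2; apply: leq_trans un.
    by rewrite ltn_neqAle ux size_wsection.
  (* Only the full sections remain: their number times wdeg u is twice wdeg u. *)
  rewrite (eq_bigr (fun=> wdeg u)) => [|x /eqP /full_wdeg //].
  rewrite sumr_const => e; have /card_gt1P[x [y [? ? ?]]] : 1 < #|full u|.
    have : #|full u| = 2; last by move->.
    by apply/(@mulrIn _ (wdeg u)) => //; apply/eqP.
  by exists x, y.
have pure u : size u <= n -> weval u = 1 -> wdeg u <> 0%R ->
    exists i x, [/\ all (fun l => l.2 == i) u, edge i x & full u x].
  move=> un u1 u0; have [x [y [xy ux uy]]] := two u un u1 u0.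
  case: u un u1 u0 ux uy => [//|[b i] u] un u1 u0 ux uy.
  have ix : edge i x by move: ux; rewrite inE full_cons => /andP[].
  have iy : edge i y by move: uy; rewrite inE full_cons => /andP[].
  by exists i, x; split=> //; apply: (two_full_pure xy) => //; exact/eqP.
apply: contrapT => w0; have [i [x [wi ix wx]]] := pure w wn w1 w0.
have [wxx wx1] := triv w x w1.
have [||j [_ [wj _ _]]] := pure (wsection w x) _ wx1.
- exact: leq_trans (size_wsection _ _) wn.
- by rewrite full_wdeg //; apply/eqP.
by apply: w0; rewrite (pure_section_wdeg ix wi wj) wxx subrr.
Qed.

End Words.

(** * The degree *)

Section Degree.
Variable d : nat.
Hypothesis d3 : 3 <= d.
Local Notation G := (G_ d).
Implicit Types (g h : tree_aut 'I_d) (w : seq (bool * 'I_d)) (i x y : 'I_d).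

Lemma G_subgroup : is_subgroup G.
Proof. exact: generated_subgroup. Qed.

Lemma G_gen i : G (gen i).
Proof. by apply: sub_generated; exists i. Qed.

Lemma G_weval w : G (weval w).
Proof.
have [G1 GM GV] := G_subgroup.
elim: w => [|[b i] w IHw] //=; apply: GM => //.
by case: b; [exact: G_gen|exact: GV (G_gen _)].
Qed.

Lemma G_word g : G g -> exists w, weval w = g.
Proof.
apply: (@generated_min _ _ [set g | exists w, weval w = g]).
  split=> [|_ _ [w <-] [w' <-]|_ [w <-]]; first by exists [::].
    by exists (w ++ w'); rewrite weval_cat.
  by exists (winv w); rewrite weval_inv.
by move=> _ [i _ <-]; exists [:: (true, i)]; rewrite /= mulg1.
Qed.

Lemma G_section g x : G g -> exists y h, G h /\ section_at g x y h.
Proof.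
move=> /G_word[w <-]; exists (wact w x), (weval (wsection w x)).
by split; [exact: G_weval|exact: weval_section].
Qed.

(** The choice of the word does not matter by wdeg_trivial. *)
Definition degree g : int :=
  xget 0%R [set n | exists2 w, weval w = g & wdeg w = n].

Lemma degree_weval w : degree (weval w) = wdeg w.
Proof.
apply: xget_unique; first by exists w.
move=> _ [w' e <-]; have := @wdeg_trivial _ d3 (w' ++ winv w).
rewrite weval_cat weval_inv e mulgV wdeg_cat wdeg_inv => /(_ erefl); lia.
Qed.

Lemma degree_gen i : degree (gen i) = 1%R.
Proof.
by have := degree_weval [:: (true, i)]; rewrite /= mulg1 addr0.
Qed.

Lemma degreeM g h : G g -> G h -> degree (g * h) = (degree g + degree h)%R.
Proof.
move=> /G_word[w <-] /G_word[w' <-].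
by rewrite -weval_cat !degree_weval wdeg_cat.
Qed.

Lemma degreeV g : G g -> degree g^-1 = (- degree g)%R.
Proof. by move=> /G_word[w <-]; rewrite -weval_inv !degree_weval wdeg_inv. Qed.

Lemma degree1 : degree 1 = 0%R.
Proof. exact: (degree_weval [::]). Qed.

Lemma degreeX g n : G g -> degree (g ^+ n) = (degree g *+ n)%R.
Proof.
move=> Gg; elim: n => [|n IHn]; first by rewrite expg0 degree1.
have GX := subgroupX n G_subgroup Gg.
by rewrite expgS degreeM // IHn mulrS.
Qed.

Lemma degreeJ g h : G g -> G h -> degree (g ^ h) = degree g.
Proof.
have [G1 GM GV] := G_subgroup; move=> Gg Gh.
by rewrite conjgE !degreeM ?degreeV //; [lia|exact: GV|exact: GM].
Qed.

End Degree.

(** * Self-replication *)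

Section SelfReplicating.
Variable d : nat.
Hypotheses (d3 : 3 <= d) (d_odd : odd d).
Local Notation G := (G_ d).
Implicit Types (g h : tree_aut 'I_d) (i j x y : 'I_d).

Lemma val_iter_ordS k i : val (iter k (@ordS d) i) = (i + k) %% d.
Proof.
elim: k => [|k IHk]; first by rewrite addn0 modn_small.
by rewrite iterS /= IHk -addn1 modnDml addn1 addnS.
Qed.

(** As d is odd, 2 generates the integers modulo d: j is reached from i by adding
whichever of j - i + d and j - i + 2 d is even. *)
Lemma step2_total (R : 'I_d -> 'I_d -> Prop) : (forall i, R i i) ->
  (forall i j k, R i j -> R j k -> R i k) -> (forall i, R i (ordS (ordS i))) ->
  forall i j, R i j.
Proof.
move=> R1 RT R2 i j.
have Riter k : R i (iter k.*2 (@ordS d) i).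
  elim: k => [|k IHk]; first exact: R1.
  by rewrite doubleS; apply: RT IHk _; apply: R2.
have [k ->] : exists k, j = iter k.*2 (@ordS d) i; last exact: Riter.
have ij := ltn_ord i; have jd := ltn_ord j.
pose r := if odd (j + d - i) then j + d + d - i else j + d - i.
exists r./2; apply: val_inj; rewrite val_iter_ordS /=.
rewrite even_halfK; last by rewrite /r; case: ifP => //; lia.
rewrite /r; case: ifP => _.
  have -> : i + (j + d + d - i) = j + 2 * d by lia.
  by rewrite addnC modnMDl modn_small.
have -> : i + (j + d - i) = j + 1 * d by lia.
by rewrite addnC modnMDl modn_small.
Qed.

(** The inverse of gen i followed by gen (ordS i) leads from i to i + 2, with
the sections (gen (ordS i))^-1 and gen (ordS i), which cancel. *)
Lemma trivial_section i j : exists2 g, G g & section_at g i j 1.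
Proof.
have [G1 GM GV] := G_subgroup d.
move: i j; apply: step2_total => [i|i j k [g Gg gij] [h Gh hjk]|i].
- by exists 1.
- by exists (g * h); [exact: GM|rewrite -[1]mul1g; apply: sectionM gij hjk].
exists ((gen i)^-1 * gen (ordS i)); first by apply: (GM) (G_gen _); exact: GV (G_gen _).
have h1 := genV_section i i; have h2 := gen_section (ordS i) (ordS i).
rewrite tpermL /edge eqxx /= in h1; rewrite tpermL /edge eqxx /= in h2.
by rewrite -[1](mulVg (gen (ordS i))); apply: sectionM h1 h2.
Qed.

(** Once moves with trivial section are available, the section gen k of gen k at
k can be transported to any letter. *)
Lemma self_replicating i j h : G h -> exists2 g, G g & section_at g i j h.
Proof.
have [G1 GM GV] := G_subgroup d.
have [t Gt tij] := trivial_section i j.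
suff jj : forall h, G h -> exists2 g, G g & section_at g j j h.
  move=> /jj[g Gg gjj]; exists (t * g); first exact: GM.
  by rewrite -[h]mul1g; apply: sectionM tij gjj.
apply: generated_min => [|_ [k _ <-]].
  split=> [|h1 h2 [g1 Gg1 s1] [g2 Gg2 s2]|h1 [g1 Gg1 s1]].
  - by exists 1.
  - by exists (g1 * g2); [exact: GM|exact: sectionM s1 s2].
  - by exists g1^-1; [exact: GV|exact: sectionV].
have [t1 Gt1 s1] := trivial_section j k.
have [t2 Gt2 s2] := trivial_section (ordS k) j.
exists (t1 * gen k * t2); first by apply: (GM) Gt2; apply: (GM) Gt1 (G_gen _).
have hk := gen_section k k; rewrite tpermL /edge eqxx /= in hk.
by have := sectionM (sectionM s1 hk) s2; rewrite mul1g mulg1.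
Qed.

End SelfReplicating.

(** * Congruence modulo a normal subgroup *)

Definition cong (gT : groupType) (N : set gT) (x y : gT) : Prop := N (x * y^-1).

Section Congruence.
Variable gT : groupType.
Variables G N : set gT.
Hypotheses (sG : is_subgroup G) (nN : normal_in G N).
Implicit Types (x y z g : gT).

Lemma cong_refl x : cong N x x.
Proof. by case: nN => [[N1 _ _] _ _]; rewrite /cong mulgV. Qed.

Lemma cong_sym x y : cong N x y -> cong N y x.
Proof.
case: nN => [[_ _ NV] _ _] xy; rewrite /cong.
by rewrite (_ : y * x^-1 = (x * y^-1)^-1); [exact: NV|rewrite invgM invgK].
Qed.

Lemma cong_trans x y z : cong N x y -> cong N y z -> cong N x z.
Proof.
case: nN => [[_ NM _] _ _] xy yz; rewrite /cong.
by rewrite (_ : x * z^-1 = (x * y^-1) * (y * z^-1)); [exact: NM|rewrite !gnorm].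
Qed.

Lemma congM x x' y y' : G x -> cong N x x' -> cong N y y' -> cong N (x * y) (x' * y').
Proof.
case: nN sG => [[_ NM _] _ NJ] [_ _ GV] Gx xx yy; rewrite /cong.
rewrite (_ : _ * _ = (y * y'^-1) ^ x^-1 * (x * x'^-1)); last first.
  by rewrite conjgE !gnorm.
by apply: NM xx; apply: NJ yy _; apply: GV.
Qed.

Lemma congV x y : G y -> cong N x y -> cong N x^-1 y^-1.
Proof.
case: nN sG => [[_ NM NV] _ NJ] [_ _ GV] Gy xy; rewrite /cong.
rewrite (_ : _ * _ = ((x * y^-1) ^ y)^-1); first by apply: NV; apply: NJ.
by rewrite conjgE !gnorm.
Qed.

Lemma congJ x y g : G g -> cong N x y -> cong N (x ^ g) (y ^ g).
Proof.
by case: nN => _ _ NJ Gg xy; rewrite /cong -conjVg -conjMg; apply: NJ.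
Qed.

End Congruence.

(** * The even part and its commutator subgroup *)

Section EvenPart.
Variable d : nat.
Hypotheses (d3 : 3 <= d) (d_odd : odd d).
Local Notation G := (G_ d).
Implicit Types (g h l u v : tree_aut 'I_d) (i j x y : 'I_d).

Definition gen2 i : tree_aut 'I_d := gen i * gen (ordS i).

(** The elements represented by words of even length, by G_even. The generators
chosen here are the conjugates of sections of squares, which can be lifted. *)
Definition even_part : set (tree_aut 'I_d) :=
  generated [set z | exists i g, G g /\ z = gen2 i ^ g].
Local Notation L := even_part.

Definition even_comm : set (tree_aut 'I_d) :=
  generated [set z | exists u v, [/\ L u, L v & z = [~ u, v]]].
Local Notation K := even_comm.

Lemma G_gen2 i : G (gen2 i).
Proof.
by have [_ GM _] := G_subgroup d; apply: GM; apply: G_gen.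
Qed.

Lemma even_normal : normal_in G L.
Proof.
have sG := G_subgroup d.
apply: normal_generated => // [_ [i [g [Gg ->]]]|_ g [i [h [Gh ->]]] Gg].
  exact: (subgroupJ sG (G_gen2 i) Gg).
apply: sub_generated; exists i, (h * g); split; last by rewrite conjgM.
by case: sG => _ GM _; apply: GM.
Qed.

Lemma even_sub : L `<=` G.
Proof. by have [] := even_normal. Qed.

Lemma even_gen2 i : L (gen2 i).
Proof.
apply: sub_generated; exists i, 1; split; last by rewrite conjg1.
by case: (G_subgroup d).
Qed.

Lemma gen2J i : gen2 i ^ gen i = gen (ordS i) * gen i.
Proof. by rewrite /gen2 conjgE !gnorm. Qed.

Lemma even_gen2' i : L (gen (ordS i) * gen i).
Proof.
have [_ _ LJ] := even_normal.
by rewrite -gen2J; apply: LJ (even_gen2 i) (G_gen i).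
Qed.

(** Modulo the even part, gen (ordS i) is the inverse of gen i, so the classes of
the generators are unchanged by steps of 2, hence all equal. *)
Lemma even_genV i j : L (gen i * (gen j)^-1).
Proof.
have [[L1 LM LV] _ _] := even_normal.
move: i j; apply: (step2_total d3 d_odd) => [i|i j k Lij Ljk|i].
- by rewrite mulgV.
- by have := LM _ _ Lij Ljk; rewrite !gnorm.
have := LM _ _ (even_gen2 i) (LV _ (even_gen2' (ordS i))).
by rewrite /gen2 !gnorm.
Qed.

Lemma even_sq i : L (gen i ^+ 2).
Proof.
have [[_ LM _] _ _] := even_normal.
by have := LM _ _ (even_genV i (ordS i)) (even_gen2' i); rewrite !gnorm expg2.
Qed.

(** All generators have the same class modulo the even part, and the square of
this class is trivial. *)
Lemma G_even i g : G g -> L g \/ L (g * (gen i)^-1).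
Proof.
have [[L1 LM LV] _ LJ] := even_normal; have Gi := G_gen i.
have Lq : L ((gen i)^-1 * (gen i)^-1).
  by rewrite -invgM -expg2; apply: LV (even_sq i).
move: g; apply: generated_min => [|_ [j _ <-]]; last by right; apply: even_genV.
split=> [|g h|g] /=; first by left.
  move=> [Lg|Lg] [Lh|Lh].
  - by left; apply: LM.
  - by right; rewrite -mulgA; apply: LM.
  - right; have := LM _ _ Lg (LJ _ (gen i)^-1 Lh _).
    rewrite conjgE !gnorm; apply.
    by have [_ _ GV] := G_subgroup d; apply: GV.
  left; have := LM _ _ Lg (LJ _ (gen i)^-1 Lh _).
  rewrite conjgE !gnorm => Lgh; have [_ _ GV] := G_subgroup d.
  have := LM _ _ (Lgh (GV _ Gi)) (even_sq i).
  by rewrite expg2 !gnorm.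
move=> [Lg|Lg]; first by left; apply: LV.
right; have := LM _ _ (LJ _ _ (LV _ Lg) Gi) Lq.
by rewrite conjgE !gnorm.
Qed.

Lemma comm_normal : normal_in G K.
Proof.
have sL := even_normal; have [[_ LM LV] _ LJ] := sL.
apply: normal_generated => [|_ [u [v [Lu Lv ->]]]|_ g [u [v [Lu Lv ->]]] Gg].
- exact: G_subgroup.
- apply: even_sub; rewrite commgEl; apply: LM; first exact: LV.
  exact: LJ Lu (even_sub Lv).
apply: sub_generated; exists (u ^ g), (v ^ g).
by rewrite conjRg; split=> //; apply: LJ.
Qed.

Lemma degree_comm g : K g -> degree g = 0%R.
Proof.
have [G1 GM GV] := G_subgroup d; have [_ KG _] := comm_normal.
move=> Kg; suff [] : (G `&` [set g | degree g = 0%R]) g by [].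
move: g Kg; apply: generated_min => [|_ [u [v [Lu Lv ->]]]].
  split=> [|x y [Gx x0] [Gy y0]|x [Gx x0]]; split=> /=.
  - by [].
  - exact: degree1.
  - exact: GM.
  - by rewrite degreeM // x0 y0.
  - exact: GV.
  - by rewrite degreeV // x0.
have Gu := even_sub Lu; have Gv := even_sub Lv.
have GJ := subgroupJ (G_subgroup d) Gu Gv.
by split; rewrite /= commgEl; [apply: GM => //; apply: GV
  |rewrite degreeM // ?degreeV // ?degreeJ //; [lia|exact: GV]].
Qed.

Lemma cong_degree g h : G g -> G h -> cong K g h -> degree g = degree h.
Proof.
have [G1 GM GV] := G_subgroup d; move=> Gg Gh /degree_comm.
by rewrite degreeM // ?degreeV //; [lia|exact: GV].
Qed.

Lemma cong_even_comm u v : L u -> L v -> cong K (u * v) (v * u).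
Proof.
have [[_ _ LV] _ _] := even_normal.
move=> Lu Lv; apply: sub_generated; exists u^-1, v^-1; split; [exact: LV..|].
by rewrite commgEl conjgE !gnorm.
Qed.

(** Conjugation by the even part is trivial on it modulo commutators, gen i
centralizes its own square, and these generate the group. *)
Lemma cong_sqJ i g : G g -> cong K (gen i ^+ 2 ^ g) (gen i ^+ 2).
Proof.
have [[_ _ LV] _ _] := even_normal; have nK := comm_normal.
have LJ l : L l -> cong K (gen i ^+ 2 ^ l) (gen i ^+ 2).
  move=> Ll; apply: sub_generated; exists l, (gen i ^+ 2)^-1.
  by split=> //; [exact: LV (even_sq i)|rewrite commgEl !conjgE !gnorm].
case/(G_even i) => [/LJ //|/LJ]; rewrite conjgM => /(congJ nK (G_gen i)).
have e : gen i ^+ 2 ^ gen i = gen i ^+ 2 by rewrite conjgE expg2 !gnorm.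
by rewrite e conjgKV.
Qed.

End EvenPart.

Arguments even_part d : clear implicits.
Arguments even_comm d : clear implicits.

(** * Lifting through the first level *)

Section Lifting.
Variable n : nat.
Local Notation d := n.+3.
Hypothesis d_odd : odd d.
Let d3 : 3 <= d := isT.
Local Notation G := (G_ d).
Local Notation L := (even_part d).
Local Notation K := (even_comm d).
Implicit Types (g h l p q u v : tree_aut 'I_d) (i x y z : 'I_d).

Let o0 : 'I_d := ord0.
Let o1 := ordS o0.
Let o2 := ordS o1.

Definition concentrated h g : Prop :=
  section_at g ord0 ord0 h /\ forall y, y != ord0 -> section_at g y y 1.

Lemma concentratedM h h' g g' :
  concentrated h g -> concentrated h' g' -> concentrated (h * h') (g * g').
Proof.
move=> [g0 gy] [g0' gy']; split; first exact: sectionM g0 g0'.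
by move=> y y0; rewrite -[1]mul1g; apply: sectionM (gy _ y0) (gy' _ y0).
Qed.

Lemma concentratedV h g : concentrated h g -> concentrated h^-1 g^-1.
Proof.
move=> [g0 gy]; split; first exact: sectionV.
by move=> y y0; rewrite -[1]invg1; apply: sectionV (gy _ y0).
Qed.

Lemma concentrated1 : concentrated 1 1.
Proof. by []. Qed.

Lemma section_preimage g y : G g -> exists x k, section_at g x y k.
Proof.
have [_ _ GV] := G_subgroup d; move=> /GV Gg.
have [x [k [_ /sectionV]]] := G_section y Gg.
by rewrite invgK => s; exists x, k^-1.
Qed.

Lemma gen_section_off i x : ~~ edge i x -> section_at (gen i) x x 1.
Proof.
by move=> ix; have := gen_section i x; rewrite (negPf ix) tperm_off.
Qed.

Lemma gen_sectionL i : section_at (gen i) i (ordS i) (gen i).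
Proof. by have := gen_section i i; rewrite tpermL /edge eqxx. Qed.

Lemma gen_sectionR i : section_at (gen i) (ordS i) i (gen (ordS i)).
Proof. by have := gen_section i (ordS i); rewrite tpermR /edge eqxx orbT. Qed.

Lemma sq_section i : section_at (gen i ^+ 2) i i (gen2 i).
Proof. by rewrite expg2; apply: sectionM (gen_sectionL i) (gen_sectionR i). Qed.

Lemma sq_sectionS i :
  section_at (gen i ^+ 2) (ordS i) (ordS i) (gen (ordS i) * gen i).
Proof. by rewrite expg2; apply: sectionM (gen_sectionR i) (gen_sectionL i). Qed.

Lemma sq_section_off i x : ~~ edge i x -> section_at (gen i ^+ 2) x x 1.
Proof.
move=> /gen_section_off s.
by rewrite expg2 -[X in section_at _ _ _ X]mulg1; exact: (sectionM s s).
Qed.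

(** The generators that do not move ord0 connect all other letters. *)
Lemma move_to1 z : z != o0 ->
  exists2 g, G g & section_at g o0 o0 1 /\ exists k, section_at g z o1 k.
Proof.
have [G1 GM _] := G_subgroup d.
have [m] := ubnP (val z); elim: m z => // m IHm z zm z0.
have [->|z1] := eqVneq z o1; first by exists 1 => //; split=> //; exists 1.
have z01 : 1 < val z.
  by move: z0 z1; rewrite -!val_eqE /= modn_small //; case: (val z) => [|[]].
have zd := ltn_ord z; have zE := prednK (ltnW z01).
have yd : (val z).-1 < d by rewrite zE; apply: ltnW.
pose y := Ordinal yd; have ez : ordS y = z.
  by apply: val_inj; rewrite val_ordS_lt /= zE.
have y0 : y != o0 by rewrite -val_eqE /= -lt0n -ltnS zE.
have [|g Gg [g0 [k gk]]] := IHm y _ y0; first by rewrite /= -ltnS zE.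
exists (gen y * g); first exact: GM (G_gen y) Gg.
split; last by exists (gen z * k); rewrite -ez; apply: sectionM (gen_sectionR y) gk.
rewrite -[1]mulg1; apply: sectionM g0; apply: gen_section_off.
by rewrite /edge ez negb_or eq_sym y0 eq_sym z0.
Qed.

Definition supported2 o l p : Prop :=
  [/\ section_at p o0 o0 l, exists k, section_at p o o k
    & forall y, y != o0 -> y != o -> section_at p y y 1].

(** The square of gen i has the nontrivial sections gen2 i and a conjugate of it,
at i and ordS i. A conjugation moves these letters to o0 and o1 and replaces the
first section by any conjugate of gen2 i, as the group is self-replicating. *)
Lemma lift_even1 l : L l -> exists2 p, L p & supported2 o1 l p.
Proof.
have [[L1 LM LV] _ LJ] := @even_normal d; have [_ GM _] := G_subgroup d.
have Lsq := even_sq d3 d_odd.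
move: l; apply: generated_min => [|_ [i [h [Gh ->]]]].
  split=> [|l l' [p Lp [p0 [k pk] py]] [p' Lp' [p0' [k' pk'] py']]|l [p Lp [p0 [k pk] py]]].
  - by exists 1 => //; split=> //; exists 1.
  - exists (p * p'); first exact: LM.
    split; [exact: sectionM p0 p0'|by exists (k * k'); apply: sectionM pk pk'|].
    by move=> y y0 y1; rewrite -[1]mul1g; apply: sectionM (py _ y0 y1) (py' _ y0 y1).
  - exists p^-1; first exact: LV.
    split; [exact: sectionV|by exists k^-1; apply: sectionV|].
    by move=> y y0 y1; rewrite -[1]invg1; apply: sectionV (py _ y0 y1).
have [t Gt ti] := self_replicating d3 d_odd i o0 Gh.
have [z [e [_ tz]]] := G_section (ordS i) Gt.
have z0 : z != o0.
  apply/eqP => z0; rewrite z0 in tz; have := section_inj tz ti.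
  by apply/eqP/ordS_neq.
have [g Gg [g0 [k gz]]] := move_to1 z0.
have Gtg := GM _ _ Gt Gg.
have tg0 : section_at (t * g) i o0 h by rewrite -[h]mulg1; apply: sectionM ti g0.
have tg1 := sectionM tz gz.
exists (gen i ^+ 2 ^ (t * g)); first exact: LJ (Lsq i) Gtg.
split; first exact: sectionJ tg0 (sq_section i).
  by exists ((gen (ordS i) * gen i) ^ (e * k)); apply: sectionJ tg1 (sq_sectionS i).
move=> y y0 y1; have [x [f xf]] := section_preimage y Gtg.
rewrite -(conj1g f); apply: (sectionJ xf (sq_section_off _)).
apply/norP; split; apply/eqP => ex; rewrite ex in xf.
  by have [e0 _] := section_fun xf tg0; rewrite e0 eqxx in y0.
by have [e0 _] := section_fun xf tg1; rewrite e0 eqxx in y1.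
Qed.

Lemma edge1_0 : ~~ edge o1 o0.
Proof. by rewrite /edge negb_or -!val_eqE. Qed.

(** Conjugation by gen o1 exchanges o1 and o2 and is trivial below o0. *)
Lemma lift_even2 l : L l -> exists2 p, L p & supported2 o2 l p.
Proof.
have [_ _ LJ] := @even_normal d.
case/lift_even1=> p Lp [p0 [k pk] py].
exists (p ^ gen o1); first exact: LJ Lp (G_gen o1).
split.
- by rewrite -[l]conjg1; apply: sectionJ p0; apply/gen_section_off/edge1_0.
- by exists (k ^ gen o1); apply: sectionJ pk; apply: gen_sectionL.
move=> y y0 y2; have [ey|y1] := eqVneq y o1.
  rewrite ey -(conj1g (gen o2)); apply: sectionJ (gen_sectionR o1) (py _ _ _).
    by rewrite -val_eqE.
  exact: ordS_neq.
rewrite -(conj1g 1); apply: sectionJ (py _ y0 y1).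
by apply: gen_section_off; rewrite /edge negb_or y1.
Qed.

(** Take lifts of u and v whose nontrivial sections are at o0, o1 and at o0, o2:
at each letter but o0 one of the two is trivial, so their commutator is
concentrated at o0, with section [~ u, v]. *)
Lemma comm_branching k : K k -> exists2 k', K k' & concentrated k k'.
Proof.
have [[K1 KM KV] _ _] := @comm_normal d.
move: k; apply: generated_min => [|_ [u [v [Lu Lv ->]]]].
  split=> [|x y [x' Kx xx] [y' Ky yy]|x [x' Kx xx]].
  - by exists 1; [|exact: concentrated1].
  - by exists (x' * y'); [exact: KM|exact: concentratedM].
  - by exists x'^-1; [exact: KV|exact: concentratedV].
have [p Lp [p0 [e p1] py]] := lift_even1 Lu.
have [q Lq [q0 [f q2] qy]] := lift_even2 Lv.
exists [~ p, q]; first by apply: sub_generated; exists p, q.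
have sectionR x a b : section_at p x x a -> section_at q x x b ->
    section_at [~ p, q] x x [~ a, b].
  by move=> pa qb; rewrite !commgEl; apply: sectionM (sectionV pa) (sectionJ qb pa).
split; first exact: sectionR.
move=> y y0; have [ey|y1] := eqVneq y o1.
  rewrite ey -(commg1 e); apply: sectionR => //; apply: qy; first by rewrite -ey.
  by rewrite eq_sym ordS_neq.
have [ey|y2] := eqVneq y o2.
  by rewrite ey -(comm1g f); apply: sectionR => //; apply: py; rewrite -ey.
by rewrite -(comm1g 1); apply: sectionR; [exact: py|exact: qy].
Qed.

End Lifting.

(** * Elements of rigid stabilizers with constant degree *)

Section Tower.
Variable n : nat.
Local Notation d := n.+3.
Hypothesis d_odd : odd d.
Let d3 : 3 <= d := isT.
Local Notation G := (G_ d).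
Local Notation L := (even_part d).
Local Notation K := (even_comm d).
Local Notation "g =K h" := (cong K g h) (at level 70).
Implicit Types (g h : tree_aut 'I_d) (i x y z : 'I_d).

Let sG : is_subgroup G := G_subgroup d.
Let nK : normal_in G K := @comm_normal d.

(** With a = gen i and b = gen (ordS i), the square of a has sections at two of
the letters i, i + 1, i + 2 only, and so have its conjugates by b and by b a, for
the two other pairs of letters. These sections cancel at i + 1 and i + 2 in the
product p of the first two and the inverse of the third, and double at i. *)
Lemma concentrated_sq i h : G h ->
  exists g, [/\ G g, g =K gen i ^+ 2 & concentrated (gen2 i ^+ 2 ^ h) g].
Proof.
have [G1 GM GV] := sG; move=> Gh.
set a := gen i; set b := gen (ordS i).
have [Ga Gb] : G a /\ G b by split; apply: G_gen.
have Gaa : G (a ^+ 2) by rewrite expg2; apply: GM.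
have Gab : G (b * a) by apply: GM.
have Gaab := subgroupJ sG Gaa Gb; have Gaaba := subgroupJ sG Gaa Gab.
have sia : i != ordS i by rewrite eq_sym ordS_neq.
have ssia : i != ordS (ordS i) by rewrite eq_sym ordSS_neq.
have ssib : ordS (ordS i) != ordS i by apply: ordS_neq.
have i_b : ~~ edge (ordS i) i by rewrite /edge negb_or sia.
have ss_a : ~~ edge i (ordS (ordS i)) by rewrite /edge negb_or ssib eq_sym ssia.
have eA : (b * a) ^ b = gen2 i by rewrite conjgE /gen2 !gnorm.
pose p1 := a ^+ 2; pose p2 := p1 ^ b; pose p3 := p2 ^ a.
have p1i : section_at p1 i i (gen2 i) := @sq_section n i.
have p1s : section_at p1 (ordS i) (ordS i) (b * a) := @sq_sectionS n i.
have p1x x : ~~ edge i x -> section_at p1 x x 1 := @sq_section_off n i x.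
have p2i : section_at p2 i i (gen2 i).
  by have := sectionJ (gen_section_off i_b) p1i; rewrite conjg1.
have p2s : section_at p2 (ordS i) (ordS i) 1.
  by have := sectionJ (gen_sectionR (ordS i)) (p1x _ ss_a); rewrite conj1g.
have p2ss : section_at p2 (ordS (ordS i)) (ordS (ordS i)) (gen2 i).
  by have := sectionJ (gen_sectionL (ordS i)) p1s; rewrite eA.
have p3i : section_at p3 i i 1.
  by have := sectionJ (gen_sectionR i) p2s; rewrite conj1g.
have p3s : section_at p3 (ordS i) (ordS i) (b * a).
  by have := sectionJ (gen_sectionL i) p2i; rewrite gen2J.
have p3ss : section_at p3 (ordS (ordS i)) (ordS (ordS i)) (gen2 i).
  by have := sectionJ (gen_section_off ss_a) p2ss; rewrite conjg1.
pose p := p1 * p2 * p3^-1.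
have Pi : section_at p i i (gen2 i ^+ 2).
  have := sectionM (sectionM p1i p2i) (sectionV p3i).
  by rewrite invg1 mulg1 expg2.
have Px x : x != i -> section_at p x x 1.
  move=> xi; have [->|xs] := eqVneq x (ordS i).
    have := sectionM (sectionM p1s p2s) (sectionV p3s).
    by rewrite mulg1 mulgV.
  have [->|xss] := eqVneq x (ordS (ordS i)).
    have := sectionM (sectionM (p1x _ ss_a) p2ss) (sectionV p3ss).
    by rewrite mul1g mulgV.
  have xa : ~~ edge i x by rewrite /edge negb_or xi.
  have xb : ~~ edge (ordS i) x by rewrite /edge negb_or xs.
  have p2x := sectionJ (gen_section_off xb) (p1x _ xa).
  have p3x := sectionJ (gen_section_off xa) p2x.
  have := sectionM (sectionM (p1x _ xa) p2x) (sectionV p3x).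
  by rewrite !conj1g invg1 !mulg1.
have p_sq : p =K a ^+ 2.
  have e : a ^+ 2 = a ^+ 2 * a ^+ 2 * (a ^+ 2)^-1 by rewrite mulgK.
  rewrite /p /p3 /p2 -conjgM [X in _ =K X]e.
  apply: (congM sG nK); [exact: GM| |].
    by apply: (congM sG nK) => //; [exact: (cong_refl nK)|exact: cong_sqJ].
  by apply: (congV sG nK) => //; exact: cong_sqJ.
have [t Gt ti] := self_replicating d3 d_odd i ord0 Gh.
exists (p ^ t); split.
- apply: (subgroupJ sG) Gt; apply: (GM); first exact: GM.
  by apply: (GV); rewrite /p3 /p2 -conjgM.
- apply: (cong_trans nK (congJ nK Gt p_sq)); exact: cong_sqJ.
split; first exact: sectionJ ti Pi.
move=> y y0; have [x [f xf]] := section_preimage y Gt.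
rewrite -(conj1g f); apply: (sectionJ xf (Px _ _)).
apply/eqP => ex; rewrite ex in xf.
by have [e0 _] := section_fun xf ti; rewrite e0 eqxx in y0.
Qed.

(** Squares would not do: the section of concentrated_sq is (gen2 i)^2, which need
not be congruent to a product of squares of generators, while its product with
its conjugate by gen i is congruent to one of fourth powers (gen2_norm). *)
Definition quartic : set (tree_aut 'I_d) :=
  generated (K `|` range (fun i => gen i ^+ 4)).
Local Notation Q := quartic.

Lemma comm_sub_quartic : K `<=` Q.
Proof. by move=> k Kk; apply: sub_generated; left. Qed.

Lemma quartic_gen i : Q (gen i ^+ 4).
Proof. by apply: sub_generated; right; exists i. Qed.

Lemma quartic_sub : Q `<=` G.
Proof.
have [_ KG _] := nK; apply: generated_min => // _ [/KG //|[i _ <-]].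
exact: subgroupX sG (G_gen i).
Qed.

(** Up to conjugation, gen2 i times its conjugate a_(i+1) a_i by a_i is the product
of the squares of a_(i+1) and a_i; the factors lie in the even part, which is
commutative modulo its commutators. *)
Lemma gen2_norm i :
  gen2 i ^+ 2 * (gen2 i ^+ 2) ^ gen i =K gen (ordS i) ^+ 4 * gen i ^+ 4.
Proof.
have [G1 GM GV] := sG; have nL := @even_normal d; have [[_ LM _] _ LJ] := nL.
have LG := @even_sub d.
have kr := cong_refl nK; have kT := cong_trans nK; have kM := congM sG nK.
set a := gen i; set b := gen (ordS i); set A := gen2 i.
have Ga : G a by apply: G_gen.
have La : L (a ^+ 2) by apply: even_sq. 
have Lb : L (b ^+ 2) by apply: even_sq.
have LA : L A by apply: even_gen2.
have LA' : L (A ^ a) by apply: LJ.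
pose c := b ^+ 2 * a ^+ 2; have Lc : L c by apply: LM.
have AA : A * A ^ a =K c.
  rewrite (_ : A * A ^ a = (b ^+ 2) ^ a^-1 * a ^+ 2); last first.
    by rewrite gen2J conjgE !expg2 /A /gen2 !gnorm.
  apply: (kM) (kr _); first by apply: (subgroupJ sG) (LG _ Lb) (GV _ Ga).
  by apply: cong_sqJ => //; apply: GV.
have cc : c * c =K b ^+ 4 * a ^+ 4.
  rewrite (_ : c * c = b ^+ 2 * ((a ^+ 2 * b ^+ 2) * a ^+ 2)); last first.
    by rewrite /c !mulgA.
  rewrite (_ : b ^+ 4 * _ = b ^+ 2 * ((b ^+ 2 * a ^+ 2) * a ^+ 2)); last first.
    by rewrite !(expgnDr _ 2 2) !mulgA.
  apply: (kM) (kr _) _; first exact: LG.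
  apply: (kM) (kr _); first by apply: LG; apply: LM.
  exact: cong_even_comm.
apply: (kT) _ cc; rewrite conjXg.
rewrite (_ : _ * _ = A * (A * A ^ a * A ^ a)); last by rewrite !expg2 !mulgA.
have GA := LG _ LA; have GA' := LG _ LA'.
apply: (kT _ (A * (A ^ a * c))).
  apply: (kM) (kr _) _ => //; apply: (kT _ (c * A ^ a)).
    by apply: (kM) (kr _) => //; apply: GM.
  exact: cong_even_comm.
by rewrite mulgA; apply: (kM) (kr _) => //; apply: GM.
Qed.

(** The inductive step towards rigid stabilizers of deep levels. The degree of g'
is that of g although g' lives one level deeper, the price being a section h of
twice this degree; it is essential that h belongs to the same subgroup. For the
generator gen i ^+ 4, g' is the product of two elements of concentrated_sq, with
conjugate sections. *)
Lemma quartic_descent g : Q g ->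
  exists g' h, [/\ G g', g' =K g, Q h & concentrated h g'].
Proof.
have [G1 GM GV] := sG; have [Q1 QM QV] : is_subgroup Q by apply: generated_subgroup.
have kT := cong_trans nK.
move=> Qg; suff [] : (G `&` [set g | exists g' h, [/\ G g', g' =K g, Q h & concentrated h g']]) g by [].
move: g Qg; apply: generated_min => [|g [Kg|[i _ <-]]].
- split=> [|g1 g2 [Gg1 [g1' [h1 [? ? ? ?]]]] [Gg2 [g2' [h2 [? ? ? ?]]]]|g [Gg [g' [h [? ? ? ?]]]]].
  + split=> //; exists 1, 1; split=> //; exact: (cong_refl nK).
  + split; first exact: GM.
    exists (g1' * g2'), (h1 * h2); split; [exact: GM|exact: (congM sG nK)|exact: QM|].
    exact: concentratedM.
  + split; first exact: GV.
    exists g'^-1, h^-1; split; [exact: GV|exact: (congV sG nK)|exact: QV|].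
    exact: concentratedV.
- have [_ KG _] := nK; split; first exact: KG.
  exists 1, 1; split=> //.
  by apply: (cong_sym nK); rewrite /cong invg1 mulg1.
split; first exact: subgroupX sG (G_gen i).
have [g1 [Gg1 k1 c1]] := concentrated_sq i G1.
have [g2 [Gg2 k2 c2]] := concentrated_sq i (G_gen i).
rewrite conjg1 in c1; exists (g1 * g2), (gen2 i ^+ 2 * (gen2 i ^+ 2) ^ gen i).
split; [exact: GM|by rewrite (expgnDr _ 2 2); apply: (congM sG nK)| |].
  rewrite -(mulgVK (gen (ordS i) ^+ 4 * gen i ^+ 4) (_ * _)).
  apply: (QM) (comm_sub_quartic (gen2_norm i)) _.
  by apply: (QM); exact: quartic_gen.
exact: concentratedM.
Qed.

(** The element h' supplied by induction for the section h is only congruent to h;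
comm_branching turns the error into one concentrated at ord0 that is again a
product of commutators. *)
Lemma quartic_rist k g : Q g ->
  exists2 g', g' =K g & rist G (nseq k ord0) g'.
Proof.
have [G1 GM GV] := sG; have [_ KG _] := nK.
elim: k g => [|k IHk] g Qg.
  exists g; first exact: (cong_refl nK).
  by split=> [|w]; [exact: quartic_sub|rewrite prefix0s].
have [g1 [h [Gg1 g1g Qh [c0 cy]]]] := quartic_descent Qg.
have [h' h'h [Gh' fix_h']] := IHk h Qh.
have [m Km [m0 my]] := comm_branching d_odd h'h.
have hE : h' * h^-1 * h = h' by rewrite mulgVK.
exists (m * g1).
  by rewrite -[g]mul1g; apply: (congM sG nK) => //; [exact: KG|rewrite /cong invg1 mulg1].
split; first by apply: (GM) => //; apply: KG.
move=> [|y v]; first by rewrite tfun_root.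
have [-> kv|y0 _] := eqVneq y ord0.
  by rewrite (sectionM m0 c0) hE fix_h' //.
by rewrite (sectionM (my _ y0) (cy _ y0)) mulg1.
Qed.

End Tower.

(** * Limit points in the profinite completion *)

Section Ultralimit.
Variable gT : groupType.
Implicit Types (G N : set gT) (s : nat -> gT).

Lemma rcoset_ofP N g x : rcoset_of N g x <-> N (x * g^-1).
Proof.
split=> [[m Nm <-]|Nx]; first by rewrite mulgK.
by exists (x * g^-1) => //; rewrite mulgVK.
Qed.

Lemma ultra_cover (T I : Type) (U : set_system I) (P : set (set T)) (s : I -> T) :
  UltraFilter U -> finite_set P -> (forall k, exists2 r, P r & r (s k)) ->
  exists2 r, P r & U [set k | r (s k)].
Proof.
move=> UU /finite_seqP[l ->] cover.
have : U [set k | exists2 r, r \in l & r (s k)].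
  by apply: filterS filterT => k _; have [r] := cover k; exists r.
elim: l {cover} => [|r l IHl] Ul.
  by have [k [r]] := filter_ex Ul; rewrite in_nil.
have [Ur|Ur] := in_ultra_setVsetC [set k | r (s k)] UU.
  by exists r => //=; rewrite mem_head.
have [|r' /= lr' Ur'] := IHl; last by exists r' => //=; rewrite in_cons lr' orbT.
apply: filterS (filterI Ul Ur) => k [[r' + sr'] nsr] /=.
rewrite in_cons => /predU1P[er|lr']; last by exists r'.
by rewrite er in sr'.
Qed.

(** The coset of N is the one that contains s k for U-almost all k; it exists, as
finitely many cosets cover the group. *)
Definition ultralimit G (U : set_system nat) s (N : profinite_index G) : set gT :=
  [set x | U [set k | sval N (x * (s k)^-1)]].

Lemma ultralimit_completion G (U : set_system nat) s :
  is_subgroup G -> UltraFilter U -> (forall k, G (s k)) ->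
  profinite_completion G (ultralimit U s).
Proof.
move=> [G1 GM GV] UU Gs; split=> [N|N N' NN' x]; last first.
  by apply: filterS => k; apply: NN'.
have [[[N1 NM NV] NG _] Nfin] := svalP N.
have [r [g Gg <-] Ug] : exists2 r, quotient_set G (sval N) r & U [set k | r (s k)].
  apply: (ultra_cover UU Nfin) => k; exists (rcoset_of (sval N) (s k)); first by exists (s k).
  by apply/rcoset_ofP; rewrite mulgV.
exists g => //; apply/seteqP; split=> [x /rcoset_ofP Nx|x Ux].
  apply: filterS Ug => k /rcoset_ofP /NV Ng.
  by have := NM _ _ Nx Ng; rewrite !gnorm.
have [k [/rcoset_ofP Ng Nx]] := filter_ex (filterI Ug Ux).
by apply/rcoset_ofP; have := NM _ _ Nx Ng; rewrite !gnorm.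
Qed.

End Ultralimit.

(** * The branch kernel *)

Section Kernel.
Variable n : nat.
Local Notation d := n.+3.
Hypothesis d_odd : odd d.
Let d3 : 3 <= d := isT.
Local Notation G := (G_ d).

Lemma rist_prefix (X : finType) (H : set (tree_aut X)) u v :
  prefix u v -> rist H v `<=` rist H u.
Proof.
move=> uv g [Hg fg]; split=> // w uw; apply: fg.
by apply: contra uw; apply: prefix_trans.
Qed.

Lemma rist_levelP (k m : nat) g : k <= m ->
  rist G (nseq m ord0) g -> rist_level G k g.
Proof.
move=> km rg; apply: sub_generated; exists (nseq k ord0); first exact: size_nseq.
by apply: rist_prefix rg; rewrite -(subnKC km) nseqD prefix_prefix.
Qed.

Definition degree_ker3 : set (tree_aut 'I_d) := [set g | G g /\ (3 %| degree g)%Z].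
Local Notation N := degree_ker3.

Lemma degree_ker3_subgroup : is_subgroup N.
Proof.
have [G1 GM GV] := G_subgroup d.
split=> [|g h [Gg g3] [Gh h3]|g [Gg g3]]; split=> //.
- by rewrite degree1.
- exact: GM.
- by rewrite degreeM // rpredD.
- exact: GV.
- by rewrite degreeV // rpredN.
Qed.

Lemma degree_ker3_finite : finite_index_normal G N.
Proof.
have sG := G_subgroup d; have [_ GM GV] := sG.
have sN := degree_ker3_subgroup; have [_ NM NV] := sN.
have G0 := G_gen (ord0 : 'I_d).
split.
  split=> // [g [] //|g h [Gg g3] Gh].
  by split; [exact: (subgroupJ sG)|rewrite degreeJ].
(* The cosets are those of the powers of gen ord0, which has degree 1. *)
apply: (sub_finite_set _ (finite_image (fun k => rcoset_of N (gen ord0 ^+ k))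
  (finite_II 3))).
move=> _ [g Gg <-]; exists `|(degree g %% 3)%Z|%N; first by rewrite /=; lia.
have GX k : G (gen ord0 ^+ k) := subgroupX k sG G0.
set k := absz _; have gk : N (g * (gen ord0 ^+ k)^-1).
  split; first by apply: (GM) => //; apply: GV.
  rewrite degreeM ?degreeV ?degreeX ?degree_gen //; last exact: GV.
  by rewrite /k; lia.
apply/seteqP; split=> x /rcoset_ofP Nx; apply/rcoset_ofP.
  by have := NM _ _ Nx (NV _ gk); rewrite !gnorm.
by have := NM _ _ Nx gk; rewrite !gnorm.
Qed.

(** The sequence lies eventually in the rigid stabilizer of each level, and always
in the coset of degree 1 modulo 3, since its terms have degree 4. *)
Lemma branch_kernel_nontrivial : exists2 c, branch_kernel G c & c <> profinite_one G.
Proof.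
have sG := G_subgroup d.
have a4 := quartic_gen (ord0 : 'I_d).
have Ga := quartic_sub a4.
have sP k : {g | cong (even_comm d) g (gen ord0 ^+ 4) & rist G (nseq k ord0) g}.
  by apply: cid2; exact: quartic_rist.
pose s k := s2val (sP k).
have sK k : cong (even_comm d) (s k) (gen ord0 ^+ 4) := s2valP (sP k).
have sR k : rist G (nseq k ord0) (s k) := s2valP' (sP k).
have Gs k : G (s k) by have [] := sR k.
have [U [UU Uoo]] := ultraFilterLemma eventually_filter.
exists (ultralimit U s).
  split; first exact: ultralimit_completion.
  apply/funext => k; rewrite /branch_map; case: pselect => // fin.
  have [[R1 RM RV] _ _] := rist_level_normal k.+1 sG.
  have Us : U [set m | rist_level G k.+1 (s m)].
    apply: Uoo; exists k.+1 => // m /= km.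
    exact: rist_levelP km (sR m).
  apply/seteqP; split=> x; rewrite /ultralimit /branch_one /= => Ux.
    have [m [Rs Rx]] := filter_ex (filterI Us Ux).
    by have := RM _ _ Rx Rs; rewrite mulgVK.
  by apply: filterS Us => m Rs; apply: (RM) => //; apply: RV.
move=> /(congr1 (fun c => c (exist _ N degree_ker3_finite) 1)).
rewrite /ultralimit /profinite_one /= => e.
have [m [_]] : exists m, N (1 * (s m)^-1).
  have U1 : U [set k | N (1 * (s k)^-1)].
    by rewrite e; split; [case: sG|rewrite degree1].
  exact: filter_ex U1.
rewrite mul1g degreeV // (cong_degree d3 d_odd (Gs m) Ga (sK m)) degreeX ?degree_gen //.
exact: G_gen.
Qed.

End Kernel.

Theorem proposition5p4 (d : nat) (hd3 : 3 <= d) (hdodd : odd d) :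
  exists2 c, branch_kernel (G_ d) c & c <> profinite_one (G_ d).
Proof.
case: d hd3 hdodd => [|[|[|n]]] // _; exact: branch_kernel_nontrivial.
Qed.
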